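(* Let $(X,\mathcal{B})$ be a spherically complete, strongly contractive ball space, and let $x\mapsto B_x$ be a function $X\to\mathcal{B}$ witnessing strong contractiveness. Then every ball $B_x$ ($x\in X$) contains a singleton ball; in other words, for every $x\in X$ there exists $a\in B_x$ such that $B_a=\{a\}$.
   Context: A ball space is a pair $(X,\mathcal{B})$ where $X$ is a nonempty set and $\mathcal{B}$ is a nonempty family of nonempty subsets of $X$; elements of $\mathcal{B}$ are called balls. A nest of balls in $(X,\mathcal{B})$ is a nonempty family $\mathcal{N}\subseteq\mathcal{B}$ that is totally ordered by inclusion. The ball space is spherically complete if $\bigcap\mathcal{N}\neq\emptyset$ for every nest of balls $\mathcal{N}\subseteq\mathcal{B}$. The ball space is strongly contractive if there is a function associating to every $x\in X$ some ball $B_x\in\mathcal{B}$ such that for all $x,y\in X$: (1) $x\in B_x$; (2) if $y\in B_x$ then $B_y\subseteq B_x$; (3) if $y\in B_x\setminus\{x\}$ then $B_y\subsetneq B_x$. Such a function is said to witness strong contractiveness. *)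

(* Defs.v *)
From mathcomp Require Import all_boot.
From mathcomp Require Import classical_sets.

Set Implicit Arguments.
Unset Strict Implicit.
Unset Printing Implicit Defensive.

Local Open Scope classical_set_scope.

Definition ball_space (X : Type) (B : set (set X)) : Prop :=
  [/\ [set: X] !=set0, B !=set0 & forall b, B b -> b !=set0].

Definition nest (X : Type) (B N : set (set X)) : Prop :=
  [/\ N !=set0, N `<=` B & total_on N subset].

Definition spherically_complete (X : Type) (B : set (set X)) : Prop :=
  forall N, nest B N -> \bigcap_(b in N) b !=set0.

Definition witnesses_strong_contractiveness
    (X : Type) (B : set (set X)) (Bf : X -> set X) : Prop :=
  [/\ forall x, B (Bf x),
      forall x, Bf x x,
      forall x y, Bf x y -> Bf y `<=` Bf x
    & forall x y, (Bf x `\ x) y -> Bf y `<` Bf x].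

(* Main.v *)
Require Import Defs.
From mathcomp Require Import all_boot.
From mathcomp Require Import boolp classical_sets.

(** Strong contractiveness makes [Bf y z] (z lies in the ball of y) a
    preorder on points: reflexivity is [Bf x x], and transitivity is the
    inclusion of [Bf y] in [Bf x] for y in [Bf x]. By spherical completeness,
    nonempty chains for this preorder are bounded ([chain_bounded]): the balls
    of a chain of points form a nest, and any point in the intersection of the
    nest bounds the chain. Zorn's lemma, applied to the points of [Bf x],
    yields a maximal point a of [Bf x]. As the inclusion above is strict when
    y is not x, the ball of a maximal point is a singleton
    ([maximal_ball_singleton]). *)

Set Implicit Arguments.
Unset Strict Implicit.
Unset Printing Implicit Defensive.

Local Open Scope classical_set_scope.

(** A point s of [Bf a] other than a has a strictly smaller ball. Maximality
    would put a in that ball, which would then contain all of [Bf a]. *)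
Lemma maximal_ball_singleton (X : Type) (B : set (set X)) (Bf : X -> set X)
    (a : X) :
  witnesses_strong_contractiveness B Bf ->
  (forall s, Bf a s -> Bf s a) -> Bf a = [set a].
Proof.
move=> [_ Bf_refl Bf_sub Bf_proper] a_max.
apply/seteqP; split=> [s Bas|s ->]; last exact: Bf_refl.
apply: contrapT => s_neq_a.
have [_] : Bf s `<` Bf a by apply: Bf_proper; split.
by apply; apply/Bf_sub/a_max.
Qed.

(** Points comparable for [Bf] have balls comparable for inclusion, so a chain of points gives a nest of balls. *)
Lemma chain_bounded (X : Type) (B : set (set X)) (Bf : X -> set X)
    (A : set X) :
  spherically_complete B -> witnesses_strong_contractiveness B Bf ->
  A !=set0 -> total_on A Bf -> exists z, forall y, A y -> Bf y z.
Proof.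
move=> hsc [Bf_ball _ Bf_sub _] [y0 Ay0] A_chain.
have [|z Nz] := hsc (Bf @` A).
  split; first by exists (Bf y0), y0.
    by move=> _ [y _ <-].
  move=> _ _ [y Ay <-] [z Az <-].
  by case: (A_chain y z Ay Az) => [/Bf_sub|/Bf_sub]; [right|left].
by exists z => y Ay; apply: Nz; exists y.
Qed.

Theorem theorem2 (X : Type) (B : set (set X)) (Bf : X -> set X)
    (hB : ball_space B) (hsc : spherically_complete B)
    (hBf : witnesses_strong_contractiveness B Bf) :
  forall x : X, exists2 a, Bf x a & Bf a = [set a].
Proof.
have [_ Bf_refl Bf_sub _] := hBf.
move=> x.
(* Restricting to the points of [Bf x] keeps the maximal point there. *)
pose T := {y : X | Bf x y}.
pose x0 : T := exist _ x (Bf_refl x).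
pose R (y z : T) := `[< Bf (sval y) (sval z) >].
have [||A A_chain|[a Bxa] a_max] := @ZL_preorder T x0 R.
- by move=> y; apply/asboolP/Bf_refl.
- by move=> y z t /asboolP Byz /asboolP Bzt; apply/asboolP/(Bf_sub _ _ Byz).
- have [[y0 Ay0]|A_empty] := pselect (A !=set0); last first.
    by exists x0 => s As; case: A_empty; exists s.
  have [||z Az] := @chain_bounded X B Bf (sval @` A) hsc hBf.
  + by exists (sval y0), y0.
  + move=> _ _ [y Ay <-] [z Az <-].
    by case: (A_chain y z Ay Az) => /asboolP; [left|right].
  have Bxz : Bf x z by apply: (Bf_sub _ _ (svalP y0)); apply: Az; exists y0.
  by exists (exist _ z Bxz) => s As; apply/asboolP/Az; exists s.
exists a => //; apply: (maximal_ball_singleton hBf) => s Bas.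
have /asboolP := a_max (exist _ s (Bf_sub _ _ Bxa _ Bas)) (asboolT Bas).
exact.
Qed.
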